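(* Let $N_1,N_2,N_3$ be positive integers with $N_1N_2N_3>1$, put $\Sigma=N_1+N_2+N_3$, $\Pi=N_1N_2N_3$, and $\Delta=(1+\Pi)^2-\frac{4}{27}\Sigma^3$. If $\Delta>0$, then the Perron eigenvalue of the matrix $$A=\begin{pmatrix}0&N_1&1\\1&0&N_2\\N_3&1&0\end{pmatrix}$$ is $$\lambda(A)=\sqrt[3]{\tfrac12\bigl(1+\Pi+\sqrt{\Delta}\bigr)}+\sqrt[3]{\tfrac12\bigl(1+\Pi-\sqrt{\Delta}\bigr)}.$$
   Context: Cube roots are real cube roots. The Perron eigenvalue of a non-negative irreducible square matrix is its spectral radius, which is an eigenvalue. *)

(* Defs.v *)
From HB Require Import structures.
From mathcomp Require Import all_boot all_order all_algebra.
From mathcomp Require Import complex.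
From mathcomp Require Import all_classical all_reals all_analysis.

Set Implicit Arguments.
Unset Strict Implicit.
Unset Printing Implicit Defensive.

Import Order.TTheory GRing.Theory Num.Theory.

Local Open Scope ring_scope.
Local Open Scope complex_scope.
Local Open Scope classical_set_scope.

(* [powR] is only the intended root on nonnegative bases, hence the sign;
   [cbrtK] and [exprK_cbrt] say that [cbrt] is the inverse of cubing on R. *)
Definition cbrt (R : realType) (x : R) : R := Num.sg x * `|x| `^ (3%:R^-1).

Lemma cbrtK (R : realType) (x : R) : cbrt x ^+ 3 = x.
Proof.
rewrite /cbrt exprMn -[X in _ * X]powR_mulrn ?powR_ge0//.
rewrite -powRrM mulVf ?pnatr_eq0// powRr1//.
have [->|x0] := eqVneq x 0; first by rewrite normr0 mulr0.
by rewrite exprS sqr_sg x0 mulr1 -numEsg.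
Qed.

Lemma exprK_cbrt (R : realType) (x : R) : cbrt (x ^+ 3) = x.
Proof.
rewrite /cbrt normrX sgrX -(powR_mulrn 3 (normr_ge0 x)) -powRrM mulfV ?pnatr_eq0// powRr1//.
have [->|x0] := eqVneq x 0; first by rewrite normr0 mulr0.
by rewrite exprS sqr_sg x0 mulr1 -numEsg.
Qed.

Definition nonneg_mx (R : realType) (n : nat) (A : 'M[R]_n) : Prop :=
  forall i j, 0 <= A i j.

(* Irreducibility as strong connectedness of the digraph with an arc i -> j
   whenever A i j != 0. *)
Definition irreducible_mx (R : realType) (n : nat) (A : 'M[R]_n) : Prop :=
  forall i j : 'I_n, connect [rel k l | A k l != 0] i j.

(* The largest modulus of a complex eigenvalue of A. *)
Definition spectral_radius (R : realType) (n : nat) (A : 'M[R]_n) : R :=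
  sup [set complex.Re `|z| | z in
        [set z : R[i] | eigenvalue (map_mx (real_complex R) A) z]].

(* The last clause is automatic (Perron-Frobenius) when the first two hold. *)
Definition is_Perron_eigenvalue (R : realType) (n : nat) (A : 'M[R]_n)
    (lambda : R) : Prop :=
  [/\ nonneg_mx A, irreducible_mx A,
      lambda = spectral_radius A & eigenvalue A lambda].

Definition mxA (R : realType) (N1 N2 N3 : nat) : 'M[R]_3 :=
  \matrix_(i < 3, j < 3)
    nth 0 (nth [::] [:: [:: 0;      N1%:R;  1     ];
                        [:: 1;      0;      N2%:R ];
                        [:: N3%:R;  1;      0     ] ] i) j.

(* Main.v *)
Require Import Defs.
From HB Require Import structures.
From mathcomp Require Import all_boot all_order all_algebra.
From mathcomp Require Import complex ring.
From mathcomp Require Import all_classical all_reals all_analysis.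

Set Implicit Arguments.
Unset Strict Implicit.
Unset Printing Implicit Defensive.

Import Order.TTheory GRing.Theory Num.Theory.

Local Open Scope ring_scope.

(* The characteristic polynomial of A is X^3 - Sigma X - (1 + Pi); Cardano's
   formula gives its root l > 0.  The modulus r of any complex eigenvalue
   satisfies r^3 <= Sigma r + (1 + Pi) by the triangle inequality, and this
   forces r <= l, so l is the spectral radius. *)

Lemma cbrt_gt0 (R : realType) (x : R) : 0 < x -> 0 < cbrt x.
Proof. by move=> x0; rewrite /cbrt gtr0_sg// mul1r powR_gt0// normr_gt0 gt_eqF. Qed.

Lemma char_poly_mxA (R : realType) (N1 N2 N3 : nat) :
  char_poly (mxA R N1 N2 N3) =
  'X^3 - ((N1 + N2 + N3)%N%:R)%:P * 'X - (1 + (N1 * N2 * N3)%N%:R)%:P.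
Proof.
rewrite /char_poly (expand_det_row _ ord0) !big_ord_recl big_ord0 /cofactor.
rewrite !(expand_det_row _ ord0) !big_ord_recl !big_ord0 /cofactor !det_mx11.
rewrite !mxE /= !(mulr1n, mulr0n) !natrD !natrM !rmorphD !rmorphM !rmorph0 !rmorph1 /= /bump /=.
ring.
Qed.

(* Cardano: the two cubes are the roots of X^2 - c X + (s/3)^3. *)
Lemma cardano_root (R : realType) (s c : R) (D := c ^+ 2 - 4 / 27 * s ^+ 3)
    (l := cbrt (2^-1 * (c + Num.sqrt D)) + cbrt (2^-1 * (c - Num.sqrt D))) :
  0 <= D -> l ^+ 3 = s * l + c.
Proof.
move=> D0; rewrite /l.
have := cbrtK (2^-1 * (c - Num.sqrt D)); have := cbrtK (2^-1 * (c + Num.sqrt D)).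
set u := cbrt (_ * (_ + _)); set v := cbrt _ => u3 v3.
have uv : u * v = s / 3.
  (* Real cube roots are unique, so it suffices to compare cubes: [u ^+ 3 * v ^+ 3 = (c ^+ 2 - D) /
     4 = (s / 3) ^+ 3]. *)
  rewrite -[LHS]exprK_cbrt -[RHS]exprK_cbrt; congr cbrt.
  rewrite exprMn u3 v3 mulrACA [(c + _) * _]mulrC -subr_sqr sqr_sqrtr// /D; by field.
have -> : (u + v) ^+ 3 = u ^+ 3 + v ^+ 3 + 3 * (u * v) * (u + v) by ring.
by rewrite u3 v3 uv; field.
Qed.

(** As [s > 0] gives [D < c ^+ 2], both radicands are positive. *)
Lemma cardano_gt0 (R : realType) (s c : R) (D := c ^+ 2 - 4 / 27 * s ^+ 3) :
  0 < s -> 0 < c ->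
  0 < cbrt (2^-1 * (c + Num.sqrt D)) + cbrt (2^-1 * (c - Num.sqrt D)).
Proof.
move=> s0 c0.
have lt_c : Num.sqrt D < c.
  rewrite -[ltRHS](gtr0_norm c0) -sqrtr_sqr ltr_sqrt ?exprn_gt0//.
  by rewrite /D ltrBlDr ltrDl mulr_gt0 ?exprn_gt0// divr_gt0.
by rewrite addr_gt0// cbrt_gt0// mulr_gt0 ?invr_gt0// ?subr_gt0// ltr_wpDr ?sqrtr_ge0.
Qed.

(** The equation for [l] gives [l ^+ 2 = s + c / l > s]. With [p x = x ^+ 3 - s * x], the
    factorization [p r - p l = (r - l) * (r ^+ 2 + r * l + (l ^+ 2 - s))] is then positive for
    [r > l], against [p r <= c = p l]. *)
Lemma cubic_le_root (R : realDomainType) (s c l r : R) :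
  0 < c -> 0 < l -> 0 <= r -> l ^+ 3 = s * l + c -> r ^+ 3 <= s * r + c ->
  r <= l.
Proof.
move=> c0 l0 r0 lE rE; rewrite leNgt; apply/negP => lr.
have ls : s < l ^+ 2 by rewrite -(ltr_pM2r l0) -exprSr lE ltrDl.
have : 0 < (r - l) * (r ^+ 2 + r * l + (l ^+ 2 - s)).
  by rewrite mulr_gt0 ?subr_gt0// ltr_wpDl ?subr_gt0// addr_ge0 ?sqr_ge0// mulr_ge0// ltW.
rewrite [ltRHS](_ : _ = r ^+ 3 - s * r - (l ^+ 3 - s * l)); last by ring.
by rewrite lE [_ + c]addrC addrK subr_gt0 ltNge lerBlDl rE.
Qed.

Lemma irreducible_mxA (R : realType) (N1 N2 N3 : nat) :
  (0 < N1)%N -> (0 < N2)%N -> (0 < N3)%N -> irreducible_mx (mxA R N1 N2 N3).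
Proof.
move=> N1_gt0 N2_gt0 N3_gt0 i j.
have [->|ij] := eqVneq i j; first exact: connect0.
(* Every off-diagonal entry is nonzero, so distinct vertices are joined by a single arc. *)
apply: connect1; move: ij => /=; rewrite mxE.
by case: i => [[|[|[|//]]] ?]; case: j => [[|[|[|//]]] ?] //= _;
  rewrite ?oner_eq0 ?pnatr_eq0 -?lt0n.
Qed.

Lemma nonneg_mxA (R : realType) (N1 N2 N3 : nat) : nonneg_mx (mxA R N1 N2 N3).
Proof.
by move=> [[|[|[|//]]] ?] [[|[|[|//]]] ?]; rewrite mxE /= ?ler01 ?ler0n.
Qed.

Lemma spectral_radius_eq (R : realType) (n : nat) (A : 'M[R]_n) (l : R) :
  0 <= l -> eigenvalue A l ->
  (forall z : R[i], root (map_poly (real_complex R) (char_poly A)) z ->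
     complex.Re `|z| <= l) ->
  spectral_radius A = l.
Proof.
move=> l0 Al le_l; apply/eqP; rewrite eq_le; apply/andP.
have evE (z : R[i]) : eigenvalue (map_mx (real_complex R) A) z =
    root (map_poly (real_complex R) (char_poly A)) z.
  by rewrite eigenvalue_root_char map_char_poly.
rewrite /spectral_radius; set S := (X in sup X).
have Sl : S l.
  exists (real_complex R l); last by rewrite ger0_norm// lecR.
  by rewrite /= evE fmorph_root -eigenvalue_root_char.
have ubS : ubound S l by move=> _ [z /= zP <-]; apply: le_l; rewrite -evE.
(* [l] serves twice: as an element making [S] nonempty, then as a bound making [sup S] dominate its
   elements. *)
split; first by apply: ge_sup => //; exists l.
by apply: ub_le_sup => //; exists l.
Qed.

Lemma cubic_normc (R : realType) (s c : R) (z : R[i]) :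
  0 <= s -> 0 <= c ->
  root (map_poly (real_complex R) ('X^3 - s%:P * 'X - c%:P)) z ->
  complex.Re `|z| ^+ 3 <= s * complex.Re `|z| + c.
Proof.
move=> s0 c0 /rootP.
rewrite !rmorphB rmorphXn rmorphM /= !map_polyC map_polyX /= !hornerE => /eqP.
rewrite subr_eq0 subr_eq => /eqP zE.
(* The norm on [R[i]] takes values in [R[i]], with zero imaginary part; the real inequality is
   lifted there by [lecR] so that the triangle inequality applies to [zE]. *)
have zN : `|z| = real_complex R (complex.Re `|z|) by rewrite normc_def.
rewrite -lecR rmorphXn rmorphD rmorphM /= -zN -normrX zE.
apply: le_trans (ler_normD _ _) _.
by rewrite normrM addrC (@ger0_norm _ (real_complex R s)) ?lecR// (@ger0_norm _ (real_complex R c)) ?lecR.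
Qed.

Theorem mainTheorem4 (R : realType) (N1 N2 N3 : nat)
    (N1_gt0 : (0 < N1)%N) (N2_gt0 : (0 < N2)%N) (N3_gt0 : (0 < N3)%N)
    (N_gt1 : (1 < N1 * N2 * N3)%N) :
  let Sigma : R := (N1 + N2 + N3)%N%:R in
  let Pi : R := (N1 * N2 * N3)%N%:R in
  let Delta : R := (1 + Pi) ^+ 2 - 4 / 27 * Sigma ^+ 3 in
  0 < Delta ->
  is_Perron_eigenvalue (mxA R N1 N2 N3)
    (cbrt (2^-1 * (1 + Pi + Num.sqrt Delta)) +
     cbrt (2^-1 * (1 + Pi - Num.sqrt Delta))).
Proof.
move=> Sigma Pi Delta Delta_gt0.
have Sigma_gt0 : 0 < Sigma by rewrite ltr0n !addn_gt0 N1_gt0.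
have c_gt0 : 0 < 1 + Pi by rewrite ltr_pwDl// ler0n.
have lE := cardano_root (ltW Delta_gt0).
have l_gt0 := cardano_gt0 Sigma_gt0 c_gt0.
(* The radicals are now forgotten: only the cubic equation and the sign of [l] are kept. *)
rewrite -/Delta in lE l_gt0; move: (_ + cbrt _) lE l_gt0 => l lE l_gt0.
have Al : eigenvalue (mxA R N1 N2 N3) l.
  rewrite eigenvalue_root_char char_poly_mxA; apply/rootP.
  by rewrite !hornerE lE /Sigma /Pi; ring.
split=> //; [exact: nonneg_mxA | exact: irreducible_mxA |].
apply/esym/spectral_radius_eq => //; first exact: ltW.
move=> z; rewrite char_poly_mxA => /(cubic_normc (ltW Sigma_gt0) (ltW c_gt0)).
apply: cubic_le_root c_gt0 l_gt0 _ lE.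
by rewrite -lecR normc_def /= lecR sqrtr_ge0.
Qed.
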